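(* Let $\widehat X=(X,h)$ be a generalized $N$-dimensional rectangle in a metric space $Z$. Let $k\in\{1,\dots,N\}$ be fixed. Assume that, for each $j\in\{1,\dots,N\}$ with $j\neq k$, there exists a compact set $\mathcal S_j\subseteq X$ such that $\mathcal S_j$ cuts the arcs between $X_j^{\ell}$ and $X_j^{r}$ in $X$. Then $\bigcap_{i\neq k}\mathcal S_i\neq\emptyset$ (intersection over $i\in\{1,\dots,N\}\setminus\{k\}$) and there exists a compact connected subset $\mathcal C$ of $\bigcap_{i\neq k}\mathcal S_i$ such that $$\mathcal C\cap X_k^{\ell}\neq\emptyset,\qquad \mathcal C\cap X_k^{r}\neq\emptyset.$$
   Context: $I^N=[0,1]^N$ and $[x_i=k]=\{x\in I^N:x_i=k\}$. A generalized $N$-dimensional rectangle of a metric space $Z$ is a pair $\widehat X=(X,h)$ where $X\subseteq Z$ and $h:I^N\to X$ is a homeomorphism of $I^N$ onto $X$. Its left and right $i$-faces are $X_i^{\ell}=h([x_i=0])$ and $X_i^{r}=h([x_i=1])$. Given closed nonempty sets $A,B,C\subseteq X$ with $A\cap B=\emptyset$, we say that $C$ cuts the arcs between $A$ and $B$ in $X$ if every continuous path $\gamma:[0,1]\to X$ whose range meets both $A$ and $B$ has range meeting $C$. (For $N=1$ the empty intersection is understood to be $X$.) *)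

(* Defs.v *)
From HB Require Import structures.
From mathcomp Require Import all_boot all_order all_algebra.
From mathcomp Require Import all_classical all_reals all_analysis.

Set Implicit Arguments.
Unset Strict Implicit.
Unset Printing Implicit Defensive.

Import Order.TTheory GRing.Theory Num.Theory.
Import numFieldNormedType.Exports.

Local Open Scope classical_set_scope.
Local Open Scope ring_scope.

Definition cube (R : realType) (N : nat) : set 'rV[R]_N :=
  [set x | forall i : 'I_N, 0 <= x ord0 i <= 1].

Definition cube_slice (R : realType) (N : nat) (i : 'I_N) (a : R) :
  set 'rV[R]_N := [set x | cube x /\ x ord0 i = a].

(* The generalized rectangle (X, h): only the values of [h] on the cube matter.
   The witness [g] is the inverse homeomorphism of X onto the cube, extended
   arbitrarily outside X. *)
Definition gen_rectangle (R : realType) (Z : metricType R) (N : nat)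
    (X : set Z) (h : 'rV[R]_N -> Z) : Prop :=
  [/\ set_bij (@cube R N) X h,
      {within @cube R N, continuous h} &
      exists2 g : Z -> 'rV[R]_N,
        (forall x, cube x -> g (h x) = x) & {within X, continuous g}].

Definition lface (R : realType) (Z : metricType R) (N : nat)
    (h : 'rV[R]_N -> Z) (i : 'I_N) : set Z := h @` cube_slice i 0.

Definition rface (R : realType) (Z : metricType R) (N : nat)
    (h : 'rV[R]_N -> Z) (i : 'I_N) : set Z := h @` cube_slice i 1.

Definition closed_nonempty_in (R : realType) (Z : metricType R)
    (X A : set Z) : Prop := [/\ A `<=` X, closed A & A !=set0].

(* [C] cuts the arcs between [A] and [B] in [X]; the standing conditions under
   which the notion is defined are part of the predicate. *)
Definition cuts_arcs (R : realType) (Z : metricType R)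
    (X A B C : set Z) : Prop :=
  [/\ closed_nonempty_in X A, closed_nonempty_in X B, closed_nonempty_in X C,
      A `&` B = set0 &
      forall gamma : R -> Z,
        {within `[0, 1]%classic, continuous gamma} ->
        gamma @` `[0, 1]%classic `<=` X ->
        (gamma @` `[0, 1]%classic) `&` A !=set0 ->
        (gamma @` `[0, 1]%classic) `&` B !=set0 ->
        (gamma @` `[0, 1]%classic) `&` C !=set0].

(* Intersecting with X makes the empty intersection (N = 1) equal to X. *)
Definition inter_except (R : realType) (Z : metricType R) (N : nat)
    (X : set Z) (k : 'I_N) (S : 'I_N -> set Z) : set Z :=
  X `&` \bigcap_(i in [set i : 'I_N | i != k]) S i.

(* Main.v *)
(* Read in the cube, the sets [S j] become closed sets [T j].  Let [A j] be [T j]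
   together with the points that a path in the complement of [T j] joins to the
   face [x j = 0], and let [B j] be the complement of these points; both are
   closed, they cover the cube, and they meet only in [T j].
   If no continuum in the intersection [K] of the [T j] joins the two [k]-faces,
   then [K] splits into two disjoint closed parts that miss one of the two
   [k]-faces each (otherwise a minimal non-splitting closed subset of [K], given
   by Zorn's lemma, would be such a continuum).  Normality turns this splitting
   into a closed cover [A k], [B k] of the cube with no common point on [K], which
   contradicts the Poincare-Miranda theorem.
   The latter follows by compactness from its discrete form on a grid, proved by a
   mod 2 degree count over the simplices of Kuhn's triangulation. *)
Require Import Defs.
From HB Require Import structures.
From mathcomp Require Import all_boot all_order all_fingroup all_algebra.
From mathcomp Require Import all_classical all_reals all_analysis.
From mathcomp Require Import zify lra.
Import Order.TTheory GRing.Theory Num.Theory.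
Import numFieldNormedType.Exports.
Set Implicit Arguments.
Unset Strict Implicit.
Unset Printing Implicit Defensive.
Local Open Scope classical_set_scope.
Local Open Scope ring_scope.

(** * Discrete Poincare-Miranda theorem *)

Lemma addF2 (x : 'F_2) : x + x = 0.
Proof. by apply/eqP; rewrite -mulr2n -mulr_natr pchar_Fp_0 ?mulr0. Qed.

Lemma det_col0 (R : comNzRingType) n (A : 'M[R]_n) (j : 'I_n) :
  (forall i, A i j = 0) -> \det A = 0.
Proof.
by move=> A0; rewrite (expand_det_col _ j) big1 // => i _; rewrite A0 mul0r.
Qed.

Lemma det_col_eq (R : comNzRingType) n (A : 'M[R]_n) (j1 j2 : 'I_n) :
  j1 != j2 -> (forall i, A i j1 = A i j2) -> \det A = 0.
Proof.
move=> j12 Aj; rewrite -det_tr; apply: (determinant_alternate j12) => i.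
by rewrite !mxE.
Qed.

(** Multiplication by a transposition pairs the odd permutations with the even ones, so every value
    occurs twice. *)
Lemma sum_perm_tperm_F2 (T : finType) (x y : T) (F : {perm T} -> 'F_2)
    (P : pred {perm T}) :
  x != y -> (forall r, P (r * tperm x y)%g = P r) ->
  (forall r, F (r * tperm x y)%g = F r) -> \sum_(r | P r) F r = 0.
Proof.
move=> xy Pt Ft; rewrite (bigID (fun r : {perm T} => odd_perm r)) /=.
rewrite (reindex_inj (mulIg (tperm x y))) /=.
under eq_bigl do rewrite Pt odd_permM odd_tperm xy addbT.
by under eq_bigr do rewrite Ft; rewrite addF2.
Qed.

Section Kuhn.
(** [s a x] stands for the sign of the [a]-th coordinate map at the grid point [x]. *)
Variables (N n : nat) (s : 'I_N -> ('I_N -> nat) -> bool).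
Hypothesis n_gt0 : (0 < n)%N.
Hypothesis s0 : forall a x, x a = 0%N -> s a x = false.
Hypothesis sn : forall a x, x a = n -> s a x = true.

Implicit Types (v : {ffun 'I_N -> 'I_n.+1}) (r : 'S_N).

(* The [j]-th vertex of the Kuhn simplex of the cell [v] in which the
   coordinate [a] is the [r a]-th one to be incremented. *)
Definition kvert v r (j : nat) : 'I_N -> nat := fun a => (v a + (r a < j))%N.

(* Since [klab d] is 1 on the level [d], expanding a determinant along this column
   yields the sum over the facets: a coboundary formula. On the face [x a = 0] the
   label [klab a] vanishes, and on [x a = n] it equals [klab a.+1]. *)
Definition klab (i : nat) (x : 'I_N -> nat) : 'F_2 :=
  [forall a : 'I_N, (i <= a)%N ==> s a x]%:R.

(* [bump m] skips the vertex [m]; for [m = d] the rows are the first [d]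
   vertices. *)
Definition kface d v r m : 'M['F_2]_d :=
  \matrix_(j, i) klab i (kvert v r (bump m j)).

(* The simplices of dimension [d] of the face [x a = n] for all [a >= d]; keeping
   the types of [v] and [r] makes the induction on [d] free of casts. *)
Definition klevel d v r :=
  [forall a : 'I_N,
    if (a < d)%N then (v a < n)%N else (v a == n :> nat) && (r a == a)].

(** On these simplices [klab i] is nondecreasing in [i] and [klab d] is 1, so a row is determined by
    the place of its first 1, and the determinant is 1 exactly when the rows are distinct. Thus
    [kdeg d] counts mod 2 the fully labelled simplices, as in Sperner's lemma. *)
Definition kdeg d : 'F_2 :=
  \sum_(p | klevel d p.1 p.2) \det (kface d.+1 p.1 p.2 d.+1).

Lemma klab0 i (a : 'I_N) x : (i <= a)%N -> x a = 0%N -> klab i x = 0.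
Proof.
move=> ia xa; rewrite /klab; case: forallP => // /(_ a).
by rewrite ia s0.
Qed.

Lemma klabS i (a : 'I_N) x : i = a -> s a x = true -> klab i x = klab i.+1 x.
Proof.
move=> -> sax; congr (_ %:R); congr nat_of_bool.
apply/forallP/forallP => /= H b; apply/implyP => ab.
  by move/implyP: (H b); apply; apply: ltnW.
have [/val_inj<-//|nab] := eqVneq (val a) (val b).
by move/implyP: (H b); apply; rewrite ltn_neqAle nab.
Qed.

Lemma kdeg0 : kdeg 0 = 1.
Proof.
rewrite /kdeg (big_pred1 ([ffun=> ord_max], 1%g)).
  rewrite /kface det_mx11 mxE /klab; case: forallP => //= -[] a.
  by rewrite sn // /kvert ffunE /= addn0.
move=> [v r] /=; rewrite xpair_eqE; apply/forallP/andP => /= [H|[/eqP-> /eqP->] a].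
  split; apply/eqP; [apply/ffunP => a|apply/permP => a].
    by rewrite ffunE; apply/val_inj; have /andP[/eqP] := H a.
  by rewrite perm1; have /andP[_ /eqP] := H a.
by rewrite ffunE perm1 !eqxx.
Qed.

Lemma klevel_ge d v r (a : 'I_N) :
  klevel d v r -> (d <= a)%N -> v a = n :> nat /\ r a = a.
Proof.
by move=> /forallP/(_ a); case: ltnP => // _ /andP[/eqP ? /eqP].
Qed.

Lemma klevel_lt d v r (a : 'I_N) : klevel d v r -> (a < d)%N -> (v a < n)%N.
Proof. by move=> /forallP/(_ a); case: ltnP. Qed.

Lemma det_kface_expand d v r : klevel d.+1 v r ->
  \det (kface d.+2 v r d.+2) = \sum_(m < d.+2) \det (kface d.+1 v r m).
Proof.
move=> lv; rewrite (expand_det_col _ ord_max); apply: eq_bigr => m _.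
have -> : kface d.+2 v r d.+2 m ord_max = 1.
  rewrite mxE /klab; case: forallP => //= -[] a; apply/implyP => da.
  have [va ra] := klevel_ge lv da.
  by rewrite sn // /kvert va ra /bump; have := ltn_ord m; lia.
rewrite mul1r /cofactor.
have -> : ((-1) ^+ (m + @ord_max d.+1) : 'F_2) = 1.
  have -> : (-1 : 'F_2) = 1 by apply/val_inj.
  by rewrite expr1n.
rewrite mul1r; congr determinant; apply/matrixP => j i; rewrite !mxE.
have /= := ltn_ord m; have /= := ltn_ord j; have /= := ltn_ord i => Hi Hj Hm.
by congr (klab _ (kvert _ _ _)); rewrite /= /bump; lia.
Qed.

(* Exchanging the steps [m] and [m.+1] only moves the vertex [m.+1], so the
   interior facets cancel in pairs. *)
Lemma kface_mid d m : (d < N)%N -> (m < d)%N ->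
  \sum_(p | klevel d.+1 p.1 p.2) \det (kface d.+1 p.1 p.2 m.+1) = 0.
Proof.
move=> dN md.
have mN : (m < N)%N by lia.
have mN' : (m.+1 < N)%N by lia.
pose x := Ordinal mN; pose y := Ordinal mN'.
have xy : x != y by rewrite -val_eqE /=; lia.
rewrite big_mkcond /= -(pair_bigA _ (fun v r => if klevel d.+1 v r then
   \det (kface d.+1 v r m.+1) else 0)) /= big1 // => v _.
rewrite -big_mkcond /=; apply: (sum_perm_tperm_F2 xy) => r.
  apply: eq_forallb => a; case: ltnP => // da; congr andb.
  rewrite permM; have [ra|ra] := eqVneq (r a) a.
    by rewrite ra tpermD ?eqxx // -val_eqE /=; lia.
  apply/negP => /eqP ta; move/eqP: ra; apply.
  by apply: (@perm_inj _ (tperm x y)); rewrite ta tpermD // -val_eqE /=; lia.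
congr determinant; apply/matrixP => j i; rewrite !mxE; congr klab.
apply/funext => a; rewrite /kvert permM; congr (_ + nat_of_bool _)%N.
rewrite /bump; case: tpermP => [->|->|//] /=; lia.
Qed.

Definition krot_val (d : nat) (i : nat) : nat :=
  if (i < d)%N then i.+1 else if (i == d)%N then 0%N else i.

Lemma krot_subproof (e i : 'I_N) : (krot_val e i < N)%N.
Proof.
have := ltn_ord i; have := ltn_ord e; rewrite /krot_val.
by case: (ltngtP i e) => /=; lia.
Qed.

Lemma krot_inj e : injective (fun i => Ordinal (krot_subproof e i)).
Proof.
move=> i j /(congr1 val) /= H; apply/val_inj => /=; move: H.
by rewrite /krot_val; case: (ltngtP i e); case: (ltngtP j e) => /=; lia.
Qed.

Definition krot e : 'S_N := perm (@krot_inj e).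

Lemma krotE e i : krot e i = krot_val e i :> nat.
Proof. by rewrite permE. Qed.

(** The coordinate incremented at step [e] is lowered by one and incremented first instead, which
    turns the vertices [j <= e] into the vertices [j.+1] as long as it was positive. The cyclic
    [ord_pred] keeps the map injective on all pairs, as reindexing needs. *)
Definition kprev (e : 'I_N) (p : {ffun 'I_N -> 'I_n.+1} * 'S_N) :=
  ([ffun a => if p.2 a == e then ord_pred (p.1 a) else p.1 a], (p.2 * krot e)%g).

Lemma kprev_inj e : injective (kprev e).
Proof.
move=> [v r] [v' r'] [/ffunP H /mulIg /= Er]; rewrite Er; congr pair.
apply/ffunP => a; have := H a; rewrite !ffunE /= Er.
by case: ifP => // _ /(can_inj (@ord_predK _)).
Qed.

Lemma ord_predE (i : 'I_n.+1) : (0 < i)%N -> ord_pred i = i.-1 :> nat.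
Proof.
move=> i0 /=; have := ltn_ord i => iN.
by rewrite (_ : (i + n.+1).-1 = i.-1 + n.+1)%N ?modnDr ?modn_small //; lia.
Qed.

Lemma kface_prev (e : 'I_N) v r : (0 < v ((r^-1)%g e))%N ->
  kface e.+1 (kprev e (v, r)).1 (kprev e (v, r)).2 0 = kface e.+1 v r e.+1.
Proof.
move=> vp; apply/matrixP => j i; rewrite !mxE; congr klab; apply/funext => a.
rewrite /kvert /kprev /= ffunE permM krotE.
have je := ltn_ord j.
have [ra|ra] := eqVneq (r a) e.
  have va : (0 < v a)%N by rewrite -ra permK in vp.
  rewrite ord_predE // ra /krot_val ltnn eqxx /bump; lia.
have {}ra : r a <> e :> nat by apply/eqP.
by rewrite /krot_val /bump; congr (_ + nat_of_bool _)%N; case: (ltngtP (r a) e); lia.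
Qed.

Lemma det_kface_zero (e : 'I_N) v r : (v ((r^-1)%g e) = 0 :> nat)%N ->
  \det (kface e.+1 v r e.+1) = 0.
Proof.
move=> v0; apply: (det_col0 (j := ord0)) => j; rewrite mxE.
apply: (@klab0 _ ((r^-1)%g e)) => //.
by rewrite /kvert v0 permKV /bump; have := ltn_ord j; lia.
Qed.

Lemma det_kface_one (e : 'I_N) v r :
  ((r^-1)%g e < e)%N -> (v ((r^-1)%g e) = n :> nat)%N ->
  \det (kface e.+1 v r e.+1) = 0.
Proof.
set a := (r^-1)%g e => ae va.
have a1 : (a < e.+1)%N by lia.
have a2 : (a.+1 < e.+1)%N by lia.
apply: (@det_col_eq _ _ _ (Ordinal a1) (Ordinal a2)) => [|j].
  by rewrite -val_eqE /=; lia.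
rewrite !mxE /=; apply: (klabS (a := a)) => //; apply: sn.
by rewrite /kvert va permKV /bump; have := ltn_ord j; lia.
Qed.

(* The facet opposite to the first vertex of a simplex is the facet opposite to
   the last vertex of the next simplex [q], with [kprev e q = p]; facets in the
   boundary of the grid vanish, except those in the face [x e = n]. *)
Lemma kface_first (e : 'I_N) :
  \sum_(p | klevel e.+1 p.1 p.2) \det (kface e.+1 p.1 p.2 0) =
  kdeg e + \sum_(p | klevel e.+1 p.1 p.2) \det (kface e.+1 p.1 p.2 e.+1).
Proof.
rewrite (reindex_inj (@kprev_inj e)) /= big_mkcond /kdeg.
rewrite [X in _ = X + _]big_mkcond [X in _ = _ + X]big_mkcond -big_split /=.
apply: eq_bigr => -[v r] _ /=.
set a := (r^-1)%g e.
have ra : r a = e by rewrite permKV.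
(* The three level conditions share [base] and differ only at [a]: they add [v a < n], [0 < v a],
   and [a = e] with [v a = n], respectively. *)
pose base := [forall b : 'I_N, if (b <= e)%N then (b == a) || (v b < n)%N
                              else (v b == n :> nat) && (r b == b)].
have rbe b : (b == a) = (r b == e) by rewrite -ra (inj_eq perm_inj).
have lvS : klevel e.+1 v r = base && (v a < n)%N.
  apply/forallP/andP => [H|[/forallP H va] b].
    split; last first.
      have := H a; case: ltnP => // ea /andP[_ /eqP aa].
      by move: ea; rewrite -aa ra ltnn.
    apply/forallP => b; have := H b; rewrite ltnS; case: (leqP b e) => // be ->.
    by rewrite orbT.
  have := H b; rewrite ltnS; case: (leqP b e) => // be.
  by case/orP => [/eqP ->|].
have lvp : klevel e.+1 (kprev e (v, r)).1 (kprev e (v, r)).2 = base && (0 < v a)%N.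
  have opn i : ((ord_pred i : 'I_n.+1) < n)%N = (0 < i)%N.
    case: (posnP i) => [i0|ip]; last by rewrite ord_predE //; have := ltn_ord i; lia.
    by rewrite /= i0 add0n /= modn_small ?ltnn.
  have kr (b : 'I_N) : (e < b)%N -> (krot e (r b) == b) = (r b == b).
    move=> eb; apply/eqP/eqP => [/(congr1 val)|->]; last first.
      by apply/val_inj; rewrite /= krotE /krot_val; case: (ltngtP b e) eb.
    rewrite /= krotE /krot_val => H; apply/val_inj => /=; move: H.
    by case: (ltngtP (r b) e); lia.
  have ab (b : 'I_N) : (e < b)%N -> r b = b -> r b != e.
    by move=> eb ->; rewrite -val_eqE /=; lia.
  apply/forallP/andP => /= [H|[/forallP H va] b].
    split; last first.
      have := H a; rewrite ltnS ffunE ra eqxx opn; case: (leqP a e) => // ea.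
      rewrite permM ra => /andP[_]; rewrite -val_eqE /= krotE /krot_val.
      by rewrite ltnn eqxx; lia.
    apply/forallP => b; have := H b; rewrite ltnS ffunE permM rbe.
    case: (leqP b e) => be.
      by case: eqP.
    rewrite kr // => /andP[+ /eqP rb]; rewrite rb.
    by rewrite -rb (negbTE (ab _ be rb)) rb eqxx andbT.
  have := H b; rewrite ltnS ffunE permM; case: (leqP b e) => be.
    by rewrite rbe; case: eqP => //= /eqP; rewrite -rbe => /eqP -> _; rewrite opn.
  by move=> /andP[vb /eqP rb]; rewrite (negbTE (ab _ be rb)) vb kr // rb eqxx.
have lve : klevel e v r = [&& base, a == e & v a == n :> nat].
  apply/forallP/and3P => [H|[/forallP H /eqP ae va] b].
    have := H e; rewrite ltnn => /andP[ve /eqP re].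
    have ae : a = e by apply: (@perm_inj _ r); rewrite ra re.
    rewrite ae ve eqxx; split => //; apply/forallP => b; have := H b.
    by rewrite ae; case: (ltngtP b e) => [be ->|//|/val_inj ->]; rewrite ?orbT ?eqxx.
  have := H b; rewrite ae; have [->|be] := eqVneq b e.
    by move=> _; rewrite ltnn -{1}ae va -{1}ae ra eqxx.
  by rewrite /=; case: (ltngtP b e) be => // /val_inj -> /eqP.
rewrite lvS lvp lve.
case: (boolP base) => //= [/forallP bs|_]; last by rewrite addr0.
(* If [0 < v a < n], both sums contain the same facet. If [v a = 0], the only facet counted
   vanishes. If [v a = n], the facet is the term of [kdeg e] when [a = e] and vanishes when [a < e];
   [base] excludes [e < a]. *)
have [v0|vpos] := posnP (v a).
  have -> : (v a == n :> nat) = false by apply/eqP; lia.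
  by rewrite det_kface_zero // andbF !if_same addr0.
rewrite kface_prev //; have [vn|vn] := ltnP (v a) n.
  by rewrite (ltn_eqF vn) andbF add0r.
have {}vn : v a = n :> nat by have := ltn_ord (v a); lia.
rewrite vn eqxx andbT addr0; case: eqVneq => [//|ae].
have [ea|ea|] := ltngtP a e; last 1 first.
- by move=> /val_inj /eqP; rewrite (negbTE ae).
- by rewrite det_kface_one.
- have := bs a; rewrite leqNgt ea /= ra => /andP[_ /eqP ea'].
  by rewrite -ea' eqxx in ae.
Qed.

(** In the sum of all facets the inner ones cancel, and the first ones give [kdeg d] plus the last
    ones, which then occur twice. *)
Lemma kdegS d : (d < N)%N -> kdeg d.+1 = kdeg d.
Proof.
move=> dN; rewrite {1}/kdeg.
rewrite (eq_bigr (fun p => \sum_(m < d.+2) \det (kface d.+1 p.1 p.2 m))); last first.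
  by move=> p; apply: det_kface_expand.
rewrite exchange_big big_ord_recl big_ord_recr /= (kface_first (Ordinal dN)) /=.
rewrite [X in _ + _ + (X + _)]big1 ?add0r => [|m _]; last exact: kface_mid.
by rewrite /bump add1n -addrA addF2 addr0.
Qed.

Lemma discrete_Poincare_Miranda : exists v : 'I_N -> nat, (forall a, v a < n)%N /\
  forall a, exists x y : 'I_N -> nat,
    [/\ s a x = false, s a y, forall b, (v b <= x b <= (v b).+1)%N &
        forall b, (v b <= y b <= (v b).+1)%N].
Proof.
have degN d : (d <= N)%N -> kdeg d = 1.
  elim: d => [_|d IH dN]; first exact: kdeg0.
  by rewrite kdegS // IH // ltnW.
have : kdeg N != 0 by rewrite degN.
case: (pickP (fun p => klevel N p.1 p.2 &&
    (\det (kface N.+1 p.1 p.2 N.+1) != 0))); last first.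
  move=> H; rewrite /kdeg big1 ?eqxx // => p lp; apply/eqP; have := H p.
  by rewrite lp => /negbFE.
move=> [v r] /= /andP[lv dv] _; exists (fun a => nat_of_ord (v a)); split => [a|a].
  exact: (klevel_lt lv (ltn_ord a)).
have vb j b : (v b <= kvert v r j b <= (v b).+1)%N.
  by rewrite /kvert leq_addr -[X in (_ <= X)%N]addn1 leq_add2l leq_b1.
suff [[j1 sj1] [j2 sj2]] : (exists j, s a (kvert v r j) = false) /\
    (exists j, s a (kvert v r j)).
  by exists (kvert v r j1), (kvert v r j2); split.
(* If [s a] held at all vertices, the columns [a] and [a.+1] would agree; if it failed at all of
   them, the column 0 would vanish. *)
split; apply: contrapT => /forallNP H; move/eqP: dv; apply.
  have a1 : (a < N.+1)%N by have := ltn_ord a; lia.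
  have a2 : (a.+1 < N.+1)%N by rewrite ltnS.
  apply: (@det_col_eq _ _ _ (Ordinal a1) (Ordinal a2)) => [|j].
    by rewrite -val_eqE /=; lia.
  rewrite !mxE /=; apply: (klabS (a := a)) => //.
  by case E: (s a _) => //; case: (H (bump N.+1 j)).
apply: (det_col0 (j := ord0)) => j; rewrite mxE /klab; case: forallP => // /(_ a) /=.
by have /negP/negbTE-> := H (bump N.+1 j).
Qed.
End Kuhn.

(** * Closed covers of the cube *)

Lemma compact_cube (R : realType) N : compact (@cube R N).
Proof.
have := @rV_compact R N (fun=> `[0, 1]%classic) (fun=> @segment_compact R 0 1).
by congr (compact _); apply/seteqP; split => x /= H i; have := H i; rewrite in_itv.
Qed.

Lemma closed_cube (R : realType) N : closed (@cube R N).
Proof. by apply: compact_closed; [exact: norm_hausdorff|exact: compact_cube]. Qed.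

Lemma rV_norm_le (R : realType) N (x : 'rV[R]_N) (e : R) :
  0 <= e -> (forall i, `|x ord0 i| <= e) -> `|x| <= e.
Proof.
move=> e0 H; rewrite /Num.norm /= mx_normrE.
by apply/bigmax_leP; split => // -[i j] _ /=; rewrite ord1.
Qed.

Lemma closed_Poincare_Miranda (R : realType) N (A B : 'I_N -> set 'rV[R]_N) :
  (forall i, closed (A i)) -> (forall i, closed (B i)) ->
  (forall i, cube_slice i 0 `<=` A i) -> (forall i, cube_slice i 1 `<=` B i) ->
  (forall i, @cube R N `<=` A i `|` B i) ->
  exists2 x, cube x & forall i, A i x /\ B i x.
Proof.
move=> cA cB A0 B1 AB.
have approx n : exists y : 'rV[R]_N, cube y /\ forall i,
    (exists2 z, A i z & `|y - z| <= n.+1%:R^-1) /\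
    (exists2 z, B i z & `|y - z| <= n.+1%:R^-1).
  pose pt (x : 'I_N -> nat) : 'rV[R]_N := \row_a ((x a)%:R / n.+1%:R).
  have n0 : 0 < n.+1%:R :> R by rewrite ltr0n.
  have cpt x : (forall a, x a <= n.+1)%N -> cube (pt x).
    by move=> xn a; rewrite mxE divr_ge0 //= ler_pdivrMr // mul1r ler_nat.
  (* Points may lie in both sets, so the values on the two [a]-faces are forced; elsewhere true
     means outside [A a], hence in [B a]. *)
  pose s a x := (x a != 0)%N && ((x a == n.+1) || `[< ~ A a (pt x) >]).
  have s0 a x : x a = 0%N -> s a x = false by rewrite /s => ->.
  have sn a x : x a = n.+1 -> s a x = true by rewrite /s => ->; rewrite eqxx.
  have [v [vn H]] := discrete_Poincare_Miranda (ltn0Sn n) s0 sn.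
  have near x : (forall b, v b <= x b <= (v b).+1)%N -> `|pt v - pt x| <= n.+1%:R^-1.
    move=> vx; apply: rV_norm_le => [|i]; first by rewrite invr_ge0 ltW.
    have ge0 : 0 <= n.+1%:R^-1 :> R by rewrite invr_ge0 ltW.
    rewrite !mxE -mulrBl normrM [X in _ * X]ger0_norm //; apply: ler_piMl => //.
    have /andP[v1 v2] := vx i.
    rewrite distrC -natrB // ger0_norm // -[leRHS]/(1%:R) ler_nat.
    by rewrite leq_subLR addn1.
  have cx x : (forall b, v b <= x b <= (v b).+1)%N -> cube (pt x).
    by move=> vx; apply: cpt => a; have /andP[_] := vx a; move/leq_trans; apply.
  exists (pt v); split=> [|i]; first by apply: cpt => a; exact: ltnW.
  have [x [y [sx sy vx vy]]] := H i; split.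
    exists (pt x); last exact: near.
    move: sx; rewrite /s; case: eqVneq => [x0 _|_ /=].
      by apply: A0; split; [exact: cx|rewrite mxE x0 mul0r].
    by move=> /norP[_ /asboolPn/contrapT].
  exists (pt y); last exact: near.
  move: sy; rewrite /s => /andP[_ /orP[/eqP yn|/asboolP nA]].
    by apply: B1; split; [exact: cx|rewrite mxE yn divff // gt_eqF].
  by have [] := AB i (pt y) (cx _ vy).
have [u Hu] := choice approx.
have cu : (u @ \oo) (@cube R N) by exists 0%N => // n _; exact: (Hu n).1.
have [x [cx clx]] := compact_cube (fmap_proper_filter u _) cu.
have lim (C : set 'rV[R]_N) : closed C ->
    (forall n, exists2 z, C z & `|u n - z| <= n.+1%:R^-1) -> C x.
  move=> cC Cu; apply: cC => V /nbhs_ballP[e /= e0 eV].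
  (* One half of [e] bounds the distance from [x] to a late term [u n], the other half that from
     [u n] to [C]. *)
  have e2 : 0 < e / 2 by rewrite divr_gt0.
  have Nu : \forall n \near \oo, (u @` [set n | n.+1%:R^-1 < e / 2]) (u n).
    near=> n; exists n => //=.
    by near: n; exact: near_infty_natSinv_lt (PosNum e2).
  have [_ [[n /= ne <-]] xu] := clx _ _ Nu (nbhsx_ballx x _ e2).
  have [z Cz uz] := Cu n; exists z; split => //; apply: eV.
  rewrite [e]splitr; apply: (ball_triangle xu).
  by rewrite -ball_normE /=; apply: le_lt_trans ne.
exists x => // i; split; apply: lim => // n; first by case: (Hu n) => _ /(_ i) [].
by case: (Hu n) => _ /(_ i) [].
Unshelve. all: by end_near.
Qed.

(** * Continua between two closed sets *)

Lemma total_on_seq_max (T : Type) (D : set (set T)) (s : seq (set T)) :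
  total_on D subset -> (forall U, U \in s -> D U) -> s != [::] ->
  exists2 O, D O & forall U, U \in s -> U `<=` O.
Proof.
move=> tD; elim: s => // V s IH sD _.
have DV : D V by apply: sD; rewrite mem_head.
have [s0|s0] := eqVneq s [::].
  by exists V => // U; rewrite s0 inE => /eqP ->.
have [|O DO sO] := IH _ s0; first by move=> U Us; apply: sD; rewrite inE Us orbT.
have [VO|OV] := tD _ _ DV DO.
  by exists O => // U; rewrite inE => /orP[/eqP ->|/sO].
exists V => // U; rewrite inE => /orP[/eqP -> //|/sO UO].
exact: subset_trans OV.
Qed.


(** Either part may be empty, so a closed set that does not split meets both [L] and [R]. *)
Definition split_between (T : topologicalType) (L R F : set T) :=
  exists F0 F1, [/\ closed F0, closed F1, F = F0 `|` F1, F0 `&` F1 = set0 &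
    F0 `&` R = set0 /\ F1 `&` L = set0].

(** This is the chain condition for Zorn's lemma. Disjoint open neighborhoods of the two parts leave
    a compact remainder of [F] covered by the chain, hence by one member [O], and [F] minus [O]
    splits along them. The first alternative covers an empty subcover. *)
Lemma split_bigcup_chain (K : realType) (T : normedModType K)
    (L R F : set T) (D : set (set T)) :
  closed L -> closed R -> L `&` R = set0 -> compact F -> closed F ->
  D `<=` open -> total_on D subset ->
  split_between L R (F `\` \bigcup_(U in D) U) ->
  split_between L R F \/ exists2 U, D U & split_between L R (F `\` U).
Proof.
move=> cL cR LR kF cF oD tD [F0 [F1 [c0 c1 FE F01 [F0R F1L]]]].
have [|U [V [oU oV FU FV UV]]] := (@normal_openP K T).1 pseudometric_normal
    (F0 `|` L) (F1 `|` R) (closedU c0 cL) (closedU c1 cR).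
  by rewrite setIUl !setIUr F01 F0R LR setIC F1L !setU0.
have splitI G : closed G -> G `<=` U `|` V -> split_between L R G.
  move=> cG GUV; exists (G `\` V), (G `\` U); split.
  - by apply: closedI => //; exact: open_closedC.
  - by apply: closedI => //; exact: open_closedC.
  - apply/seteqP; split=> x; last by case=> -[].
    move=> Gx; have [Ux|Vx] := GUV _ Gx; [left|right]; split => // ?.
      by have : (U `&` V) x by []; rewrite UV.
    by have : (U `&` V) x by []; rewrite UV.
  - by rewrite -subset0 => x [[Gx nVx] [_ nUx]]; have [] := GUV _ Gx.
  - split; rewrite -subset0 => x [[Gx nx] Lx]; apply: nx;
      by [apply: FV; right|apply: FU; right].
have kG : compact (F `\` (U `|` V)).
  apply: subclosed_compact kF _; last by move=> x [].
  by apply: closedI => //; apply: open_closedC; exact: openU.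
have cov : F `\` (U `|` V) `<=` cover D id.
  move=> x [Fx nUV]; apply: contrapT => nD; apply: nUV.
  have : (F `\` \bigcup_(U in D) U) x by [].
  by rewrite FE => -[?|?]; [left; apply: FU; left|right; apply: FV; left].
move: kG; rewrite (@compact_cover T) => /(_ _ _ _ oD cov) [D' D'D FD'].
have [D0|D0] := eqVneq (finmap.enum_fset D') [::].
  left; apply: splitI => // x Fx; apply: contrapT => nUV.
  have [W /= WD' _] := FD' x (conj Fx nUV).
  have : W \in finmap.enum_fset D' by [].
  by rewrite D0.
have [|O DO D'O] := total_on_seq_max tD _ D0.
  by move=> W /D'D; rewrite inE.
right; exists O => //; apply: splitI.
  by apply: closedI => //; apply: open_closedC; exact: oD.
move=> x [Fx nOx]; apply: contrapT => nUV; apply: nOx.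
have [W /= WD' Wx] := FD' x (conj Fx nUV).
exact: D'O Wx.
Qed.

Lemma connected_between (K : realType) (T : normedModType K)
    (L R F : set T) :
  closed L -> closed R -> L `&` R = set0 -> compact F -> closed F ->
  ~ split_between L R F ->
  exists C, [/\ compact C, connected C, C `<=` F, C `&` L !=set0 & C `&` R !=set0].
Proof.
move=> cL cR LR kF cF nsF.
have nonsplit_meets G : closed G -> ~ split_between L R G ->
    G `&` L !=set0 /\ G `&` R !=set0.
  move=> cG nsG; split; apply/set0P/negP => /eqP G0; apply: nsG.
    by exists set0, G; split; rewrite ?set0U ?set0I //; exact: closed0.
  by exists G, set0; split; rewrite ?setU0 ?setI0 ?set0I //; exact: closed0.
(* Zorn's lemma is used for unions of open sets: a maximal [O] gives a minimal non-splitting [F]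
   minus [O]. *)
pose P O := open O /\ ~ split_between L R (F `\` O).
have [|A [[oA nsA] Amax]] := @Zorn_bigcup T P.
  move=> D DP tD; split; first by apply: bigcup_open => U /DP[].
  move=> /split_bigcup_chain[]//; first by move=> U /DP[].
  by case=> U /DP[].
pose C := F `\` A.
have cC : closed C by apply: closedI => //; exact: open_closedC.
have [CL CR] := nonsplit_meets C cC nsA.
exists C; split => //; last by move=> x [].
  by apply: subclosed_compact kF _ => // x [].
apply: contrapT => /connectedPn[E [E0 CE [E1 E2]]].
have cE b : closed (E b).
  have EC : E b `<=` C by rewrite CE; case: b; [right|left].
  apply/closure_id/seteqP; split; first exact: subset_closure.
  move=> x Ex; have : C x by apply: cC; apply: closure_subset Ex.
  rewrite CE; case: b EC Ex => EC Ex []// Ex'.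
    by have : (E false `&` closure (E true)) x by []; rewrite E2.
  by have : (closure (E false) `&` E true) x by []; rewrite E1.
have disjE : E false `&` E true = set0.
  by apply: separated_disjoint.
(* Each piece of a separation of [C] is a proper closed subset, so it splits by minimality; the two
   splittings together split [C]. *)
have sE b : split_between L R (E b).
  have EC : E b `<=` C by rewrite CE; case: b; [right|left].
  apply: contrapT => nsE; apply: (Amax (~` E b)); last first.
    split; first exact: closed_openC.
    rewrite setDE setCK (_ : F `&` E b = E b) //.
    by apply/setIidr => x /EC[].
  split; first by move=> x Ax Ebx; have [] := EC x Ebx.
  have [x Ex] := E0 (~~ b); move=> /(_ x) H.
  have Cx : C x by rewrite CE; move: Ex; case: (b); [left|right].
  apply: Cx.2; apply: H => Ebx; move: Ex Ebx; case: (b) => /= Ex Ex'.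
    by have : (E false `&` E true) x by []; rewrite disjE.
  by have : (E false `&` E true) x by []; rewrite disjE.
have [G0 [G1 [cG0 cG1 GE G01 [G0R G1L]]]] := sE false.
have [H0 [H1 [cH0 cH1 HE H01 [H0R H1L]]]] := sE true.
apply: nsA; exists (G0 `|` H0), (G1 `|` H1); split.
- exact: closedU.
- exact: closedU.
- by rewrite -/C CE GE HE setUACA.
- have Ed x : ~ (E false x /\ E true x).
    by move=> H; have : (E false `&` E true) x by []; rewrite disjE.
  rewrite -subset0 => x [[g|g] [h|h]].
  + by rewrite -G01.
  + by case: (Ed x); rewrite GE HE; split; [left|right].
  + by case: (Ed x); rewrite GE HE; split; [right|left].
  + by rewrite -H01.
- by rewrite !setIUl G0R H0R G1L H1L setU0.
Qed.

(** * Reachable points *)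

Definition clamp01 (R : realType) (t : R) : R := Num.min (Num.max t 0) 1.

Lemma clamp01_continuous (R : realType) : continuous (@clamp01 R).
Proof.
move=> t; apply: (@continuous_min R R^o (fun s => Num.max s 0) (fun=> 1)); last first.
  exact: cst_continuous.
apply: (@continuous_max R R^o id (fun=> 0)); last exact: cst_continuous.
exact: cvg_id.
Qed.

Lemma clamp01_itv (R : realType) (t : R) : 0 <= clamp01 t <= 1.
Proof. by rewrite /clamp01 le_min le_max ge_min !lexx ler01 !orbT. Qed.

Lemma clamp01_le0 (R : realType) (t : R) : t <= 0 -> clamp01 t = 0.
Proof. by move=> t0; rewrite /clamp01 (max_r t0) min_l. Qed.

Lemma clamp01_ge1 (R : realType) (t : R) : 1 <= t -> clamp01 t = 1.
Proof. by move=> t1; rewrite /clamp01 min_r // le_max t1. Qed.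

(** Paths are defined on all of [R], so that their continuity is not relative to a segment. *)
Definition reachable (R : realType) (V : normedModType R) (E L : set V) : set V :=
  [set x | exists gamma : R -> V,
    [/\ continuous gamma, forall t, E (gamma t), L (gamma 0) & gamma 1 = x]].

(* The path is traversed at double speed and then followed by the segment; the
   clamps turn this concatenation into a sum of continuous functions. *)
Lemma reachable_segment (R : realType) (V : normedModType R) (E L : set V) x y :
  reachable E L x -> (forall c : R, 0 <= c <= 1 -> E (x + c *: (y - x))) ->
  reachable E L y.
Proof.
move=> [g [gc gE gL g1]] seg.
exists (fun t => g (clamp01 (2 * t)) + clamp01 (2 * t - 1) *: (y - x)); split.
- have mulc : continuous (fun t : R => 2 * t) by exact: mulrl_continuous.
  move=> t; apply: cvgD.
    apply: (@continuous_comp _ _ _ (fun t : R => clamp01 (2 * t)) g); last exact: gc.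
    by apply: (continuous_comp (mulc t)); exact: clamp01_continuous.
  apply: cvgZr_tmp.
  apply: (@continuous_comp _ _ _ (fun t : R => 2 * t - 1) (@clamp01 R));
    last exact: clamp01_continuous.
  by apply: cvgB; [exact: mulc|exact: cst_continuous].
- move=> t; have [t2|t2] := leP t (1 / 2).
    by rewrite [clamp01 (2 * t - 1)]clamp01_le0 ?scale0r ?addr0//; lra.
  by rewrite [clamp01 (2 * t)]clamp01_ge1 ?g1; [exact/seg/clamp01_itv|lra].
- by rewrite mulr0 !clamp01_le0 ?scale0r ?addr0 //; lra.
- by rewrite mulr1 !clamp01_ge1 ?g1 ?scale1r; [rewrite addrC subrK|lra|lra].
Qed.

Lemma ball_segment (R : realType) (V : normedModType R) (z x y : V) (e c : R) :
  ball z e x -> ball z e y -> 0 <= c <= 1 -> ball z e (x + c *: (y - x)).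
Proof.
rewrite -ball_normE /= => zx zy /andP[c0 c1].
have -> : z - (x + c *: (y - x)) = (1 - c) *: (z - x) + c *: (z - y).
  have -> : z - y = (z - x) - (y - x) by rewrite opprB addrA subrK.
  by rewrite [c *: (_ - (y - x))]scalerBr addrA -scalerDl subrK scale1r opprD addrA.
apply: le_lt_trans (ler_normD _ _) _; rewrite !normrZ.
rewrite (ger0_norm c0) ger0_norm ?subr_ge0 //.
(* Strictness comes from the second term when [c] is positive and from the first when [c] is 0. *)
have [|c0'] := eqVneq c 0; first by move=> ->; lra.
have {}c0 : 0 < c by rewrite lt_neqAle eq_sym c0'.
nra.
Qed.

Lemma cube_segment (R : realType) N (x y : 'rV[R]_N) (c : R) :
  cube x -> cube y -> 0 <= c <= 1 -> cube (x + c *: (y - x)).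
Proof.
move=> cx cy /andP[c0 c1] i; rewrite !mxE.
by have := cx i; have := cy i => /andP[? ?] /andP[? ?]; nra.
Qed.

Section CubeReach.
Context (R : realType) (N : nat) (T L : set 'rV[R]_N).
Hypothesis cT : closed T.

Let reach := reachable (@cube R N `\` T) L.

Lemma reach_cube : reach `<=` @cube R N `\` T.
Proof. by move=> x [g [_ gE _ <-]]. Qed.

(** A ball off [T] meets the cube in a convex set, so reachability is locally constant off [T]; both
    closedness results below rest on this. *)
Lemma reach_ball z : cube z -> ~ T z -> exists2 e : R, 0 < e &
  forall x y, ball z e x -> ball z e y -> cube y -> reach x -> reach y.
Proof.
move=> cz nTz.
have /nbhs_ballP[e /= e0 eT] : nbhs z (~` T).
  by apply: open_nbhs_nbhs; split => //; exact: closed_openC.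
exists e => // x y zx zy cy rx; apply: (reachable_segment rx) => c c01; split.
  by apply: cube_segment => //; have [] := reach_cube rx.
by apply: eT; exact: ball_segment.
Qed.

Lemma closed_reachU : T `<=` @cube R N -> closed (T `|` reach).
Proof.
move=> Tc z cl.
have cz : cube z.
  apply: closed_cube; apply: closure_subset cl => x [/Tc//|/reach_cube[]//].
apply: contrapT => /not_orP[nTz nrz].
have [e e0 re] := reach_ball cz nTz.
have /nbhs_ballP[d /= d0 dT] : nbhs z (~` T).
  by apply: open_nbhs_nbhs; split => //; exact: closed_openC.
have [y [Ty [dy ey]]] := cl _ (filterI (nbhsx_ballx z d d0) (nbhsx_ballx z e e0)).
case: Ty => [/(dT _ dy)//|ry].
by apply: nrz; apply: re ry => //; exact: ballxx.
Qed.

Lemma closed_cube_unreach : closed (@cube R N `\` reach).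
Proof.
move=> z cl; have cz : cube z.
  by apply: closed_cube; apply: closure_subset cl => x [].
split=> // rz; have [_ nTz] := reach_cube rz.
have [e e0 re] := reach_ball cz nTz.
have [y [[cy nry] zy]] := cl _ (nbhsx_ballx z e e0).
by apply: nry; apply: re rz => //; exact: ballxx.
Qed.
End CubeReach.

(** * Connectors in the cube *)

Lemma closed_cube_slice (R : realType) N (i : 'I_N) (a : R) :
  closed (cube_slice i a).
Proof.
apply: closedI; first exact: closed_cube.
apply: (@closed_comp _ _ (fun x : 'rV[R]_N => x ord0 i) [set a]) => [x _|].
  exact: coord_continuous.
exact: closed_eq.
Qed.

Lemma cube_connector (R : realType) N (k : 'I_N) (T : 'I_N -> set 'rV[R]_N) :
  (forall j, j != k -> closed (T j)) -> (forall j, j != k -> T j `<=` @cube R N) ->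
  (forall j, j != k -> forall gamma : R -> 'rV[R]_N, continuous gamma ->
    (forall t, cube (gamma t)) -> cube_slice j 0 (gamma 0) ->
    cube_slice j 1 (gamma 1) -> exists t, T j (gamma t)) ->
  exists C, [/\ compact C, connected C,
    C `<=` @cube R N `&` \bigcap_(j in [set j | j != k]) T j,
    C `&` cube_slice k 0 !=set0 & C `&` cube_slice k 1 !=set0].
Proof.
move=> cT Tc cut.
have cK : closed (@cube R N `&` \bigcap_(j in [set j | j != k]) T j).
  by apply: closedI; [exact: closed_cube|apply: closed_bigI => j; exact: cT].
have slice01 : cube_slice k 0 `&` cube_slice k 1 = set0 :> set 'rV[R]_N.
  rewrite -subset0 => x [[_ x0] [_ x1]]; have /eqP := x0.
  by rewrite x1 oner_eq0.
apply: (@connected_between R 'rV[R]_N) => //; try exact: closed_cube_slice.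
  by apply: subclosed_compact cK (@compact_cube R N) _ => x [].
move=> [K0 [K1 [c0 c1 KE K01 [K0r K1l]]]].
have [|U [V [oU oV KU KV UV]]] := (@normal_openP R 'rV[R]_N).1 pseudometric_normal
    (K0 `|` cube_slice k 0) (K1 `|` cube_slice k 1)
    (closedU c0 (@closed_cube_slice R N k 0)) (closedU c1 (@closed_cube_slice R N k 1)).
  by rewrite setIUl !setIUr K01 K0r slice01 setIC K1l !setU0.
pose reach j := reachable (@cube R N `\` T j) (cube_slice j 0).
(* For [j = k] the complements of [V] and [U] contain the faces [x k = 0] and [x k = 1], cover the
   cube because [U] and [V] are disjoint, and have no common point in [K0] or [K1]. *)
pose A j := if j == k then ~` V else T j `|` reach j.
pose B j := if j == k then ~` U else @cube R N `\` reach j.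
have [|||||x cx xAB] := @closed_Poincare_Miranda R N A B.
- move=> j; rewrite /A; case: eqVneq => [_|jk]; first exact: open_closedC.
  by apply: closed_reachU; [exact: cT|exact: Tc].
- move=> j; rewrite /B; case: eqVneq => [_|jk]; first exact: open_closedC.
  by apply: closed_cube_unreach; exact: cT.
- move=> j x xj; rewrite /A; case: eqVneq => [jk Vx|jk].
    have : (U `&` V) x by split => //; apply: KU; right; rewrite -jk.
    by rewrite UV.
  have [Tx|nTx] := pselect (T j x); [by left|right].
  by exists (fun=> x); split => //; [exact: cst_continuous|case: xj].
- move=> j x xj; rewrite /B; case: eqVneq => [jk Ux|jk].
    have : (U `&` V) x by split => //; apply: KV; right; rewrite -jk.
    by rewrite UV.
  split; first by case: xj.
  (* A reachable point of the opposite face would give a path between the two [j]-faces that avoids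
     [T j]. *)
  move=> [g [gc gE g0 g1]].
  have [||t Tt] := cut j jk g gc _ g0; last by case: (gE t).
    by move=> t; case: (gE t).
  by rewrite g1.
- move=> j x cx; rewrite /A /B; case: eqVneq => [_|_].
    have [Ux|nUx] := pselect (U x); [left|by right].
    by move=> Vx; have : (U `&` V) x by []; rewrite UV.
  by have [rx|nrx] := pselect (reach j x); [left; right|right].
have Kx : (K0 `|` K1) x.
  rewrite -KE; split => // j /= jk; have := xAB j.
  by rewrite /A /B (negbTE jk) => -[[//|rx] [_ /(_ rx)]].
have := xAB k; rewrite /A /B eqxx => -[nV nU].
by case: Kx => Kx; [apply: nU; apply: KU|apply: nV; apply: KV]; left.
Qed.

(** * Transfer to the generalized rectangle *)

Lemma continuous_comp_within (R S U : topologicalType) (A : set S)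
    (f : R -> S) (g : S -> U) :
  continuous f -> (forall t, A (f t)) -> {within A, continuous g} ->
  continuous (g \o f).
Proof.
move=> fc fA gc t.
have H : f @ t --> within A (nbhs (f t)).
  move=> P /= AP; have := fc t _ AP.
  by apply: (@filterS _ (nbhs t) _ _ (f @^-1` P)) => u Pu; exact: Pu (fA u).
exact: (cvg_comp f g H ((subspace_continuousP A g).1 gc _ (fA t))).
Qed.

Theorem corollary4p1 (R : realType) (Z : metricType R) (N : nat)
    (X : set Z) (h : 'rV[R]_N -> Z) (k : 'I_N) (S : 'I_N -> set Z)
    (hX : gen_rectangle X h)
    (hS : forall j : 'I_N, j != k ->
       [/\ compact (S j), S j `<=` X &
           cuts_arcs X (lface h j) (rface h j) (S j)]) :
  inter_except X k S !=set0 /\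
  exists C : set Z,
    [/\ compact C, connected C, C `<=` inter_except X k S,
        C `&` lface h k !=set0 & C `&` rface h k !=set0].
Proof.
case: hX => -[hcX _ hsurj] hc [g gh gc].
(* The intersection is nonempty because it contains a continuum meeting a face. *)
suff [C [kC conC CS Cl Cr]] : exists C : set Z,
    [/\ compact C, connected C, C `<=` inter_except X k S,
        C `&` lface h k !=set0 & C `&` rface h k !=set0].
  split; last by exists C.
  by case: Cl => z [Cz _]; exists z; exact: CS.
(* As [g] inverts [h] on the cube, the image of [S j] under [g] is [S j] read in the cube. *)
have gS j : S j `<=` X -> forall x, (g @` S j) x -> cube x /\ S j (h x).
  move=> SX _ [z Sz <-]; have [x cx xz] := hsurj _ (SX _ Sz).
  by rewrite -xz gh // xz.
have [|||C [kC conC CT [x0 [Cx0 sx0]] [x1 [Cx1 sx1]]]] :=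
    @cube_connector R N k (fun j => g @` S j).
- move=> j /hS[kS SX _]; apply: compact_closed; first exact: norm_hausdorff.
  by apply: continuous_compact kS; apply: continuous_subspaceW gc.
- by move=> j /hS[_ SX _] x /(gS _ SX)[].
- move=> j /hS[_ SX [_ _ _ _ cut]] gam gamc gamcube gam0 gam1.
  have hgc := continuous_comp_within gamc gamcube hc.
  have [||||z [[t /= t01 <-] Sz]] := cut (h \o gam).
  + exact: continuous_subspaceT.
  + by move=> _ [t _ <-]; apply: hcX.
  + exists (h (gam 0)); split; last by exists (gam 0).
    by exists 0 => //=; rewrite in_itv /= lexx ler01.
  + exists (h (gam 1)); split; last by exists (gam 1).
    by exists 1 => //=; rewrite in_itv /= lexx ler01.
  + by exists t, (h (gam t)) => //; exact: gh.
have Ccube : C `<=` @cube R N by move=> x /CT[].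
have hcC : {within C, continuous h} by exact: continuous_subspaceW hc.
exists (h @` C); split.
- exact: continuous_compact.
- exact: connected_continuous_connected.
- move=> _ [x Cx <-]; split; first exact/hcX/Ccube.
  move=> j /= jk; have [_ /(_ j jk) gx] := CT x Cx.
  by have [_ SX _] := hS j jk; have [] := gS j SX x gx.
- by exists (h x0); split; [exists x0|exists x0].
- by exists (h x1); split; [exists x1|exists x1].
Qed.
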